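(* Let $\Omega\subset\mathbb{C}^n$ ($n\geq2$) be a bounded domain equipped with a Finsler metric $F$ whose distance $d_F$ is complete, and assume $(\Omega,d_F)$ is Gromov hyperbolic. Suppose there are constants $C_1,C_2,\alpha>0$ and $0<\beta<1$ such that \[ d_F(x,y)\geq \alpha\left|\log\left(\frac{\delta(x)}{\delta(y)}\right)\right|-C_1\quad\text{for all }x,y\in\Omega, \] and \[ F(z,X)\geq\frac{C_2|X|}{\delta(z)^{\beta}}\quad\text{for all }z\in\Omega,\ 0\neq X\in\mathbb{C}^n. \] Let $\lambda\ge1$. Then there exists a constant $C=C(\lambda)>0$ such that for all $x,y\in\Omega$ and every Finsler $\lambda$-quasi-geodesic $\gamma$ in $\Omega$ connecting $x$ and $y$, \[ d_F(x,y)\geq2\alpha\log\left(\frac{L(\gamma)^{\frac{1}{\beta}}}{\sqrt{\delta(x)\delta(y)}}\right)-C, \] where $L(\gamma)$ is the Euclidean length of $\gamma$.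
   Context: $\delta(z)$ is the Euclidean distance from $z$ to $\partial\Omega$. A Finsler metric on $\Omega$ is an upper semicontinuous map $F:\Omega\times\mathbb{C}^n\to[0,\infty)$ with $F(z;tX)=|t|F(z;X)$ for $t\in\mathbb{C}$; its distance $d_F(x,y)$ is the infimum of $\int_0^1F(\gamma(t);\dot\gamma(t))\,dt$ over piecewise $C^1$ curves $\gamma:[0,1]\to\Omega$ from $x$ to $y$. $(\Omega,d_F)$ is Gromov hyperbolic if it is a proper geodesic metric space and there is $\delta_0\ge0$ with $(x|y)_\omega\ge\min\{(x|z)_\omega,(z|y)_\omega\}-\delta_0$ for all $x,y,z,\omega$, where $(x|y)_\omega=\frac12(d_F(x,\omega)+d_F(y,\omega)-d_F(x,y))$. A Finsler $\lambda$-quasi-geodesic is a curve $\gamma:I\to\Omega$ with $\lambda^{-1}|t-s|\le d_F(\gamma(t),\gamma(s))\le\lambda|t-s|$ for all $s,t\in I$. The constant $C$ may also depend on $\Omega,F$ and the given constants. *)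

(* Defs.v *)
(* C^n is modelled as pairs (Re, Im) of real row
   vectors: z = (x, y) stands for x + i y with x y : 'rV[R]_n. *)
From mathcomp Require Import all_boot all_order all_algebra.
From mathcomp Require Import all_classical all_reals all_analysis.
Set Implicit Arguments. Unset Strict Implicit. Unset Printing Implicit Defensive.
Import Order.TTheory GRing.Theory Num.Theory numFieldNormedType.Exports.
Local Open Scope classical_set_scope.
Local Open Scope ring_scope.

Section Finsler.
Variables (R : realType) (n : nat).

Definition Cn := ('rV[R]_n * 'rV[R]_n)%type.

Definition enorm (z : Cn) : R :=
  Num.sqrt (\sum_(i < n) ((z.1 ord0 i) ^+ 2 + (z.2 ord0 i) ^+ 2)).

(* complex scalar multiplication: (a + i b) * (x + i y) *)
Definition cscale (a b : R) (X : Cn) : Cn :=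
  (a *: X.1 - b *: X.2, a *: X.2 + b *: X.1).

Definition bounded_domain (Om : set Cn) : Prop :=
  [/\ Om !=set0, open Om, connected Om & exists M : R, forall z, Om z -> enorm z <= M].

Definition delta (Om : set Cn) (z : Cn) : R :=
  inf [set enorm (z - w) | w in closure Om `\` Om].

Definition is_finsler (Om : set Cn) (F : Cn -> Cn -> R) : Prop :=
  [/\ (forall z X, Om z -> 0 <= F z X),
      (forall z X (a b : R), Om z ->
          F z (cscale a b X) = Num.sqrt (a ^+ 2 + b ^+ 2) * F z X) &
      (forall z X, Om z -> forall r : R, F z X < r ->
          \forall w \near (z, X), Om w.1 -> F w.1 w.2 < r)].

Definition piecewise_C1 (g : R -> Cn) : Prop :=
  {within `[0%R, 1%R], continuous g} /\
  exists s : seq R, [/\ path <%R 0 s, last 0 s = 1 &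
    forall i, (i < size s)%N ->
      let t := nth 0 (0 :: s) i in let u := nth 0 s i in
      [/\ (forall x, t < x < u -> derivable g x 1),
          {within `]t, u[, continuous (derive1 g)},
          cvg (derive1 g x @[x --> t^'+]) &
          cvg (derive1 g x @[x --> u^'-])]].

Definition F_length (F : Cn -> Cn -> R) (g : R -> Cn) : \bar R :=
  (\int[lebesgue_measure]_(t in `[0%R, 1%R]) (F (g t) (derive1 g t))%:E)%E.

Definition admissible (Om : set Cn) (x y : Cn) : set (R -> Cn) :=
  [set g | [/\ piecewise_C1 g, (forall t, 0 <= t <= 1 -> Om (g t)),
              g 0 = x & g 1 = y]].

(* the Finsler distance d_F (finite on a domain) *)
Definition dF (Om : set Cn) (F : Cn -> Cn -> R) (x y : Cn) : R :=
  fine (ereal_inf [set F_length F g | g in admissible Om x y]).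

Section Metric.
Variables (Om : set Cn) (F : Cn -> Cn -> R).
Local Notation d := (dF Om F).

Definition dF_complete : Prop :=
  forall u : nat -> Cn, (forall k, Om (u k)) ->
    (forall e : R, 0 < e -> exists N : nat, forall m k : nat,
        (N <= m)%N -> (N <= k)%N -> d (u m) (u k) < e) ->
    exists2 p, Om p & (fun k => d (u k) p) @ \oo --> 0.

Definition dF_separates : Prop :=
  forall x y, Om x -> Om y -> d x y = 0 -> x = y.

Definition dF_proper : Prop :=
  forall (p : Cn) (r : R) (u : nat -> Cn), Om p ->
    (forall k, Om (u k) /\ d p (u k) <= r) ->
    exists (phi : nat -> nat) (q : Cn),
      [/\ {homo phi : a b / (a < b)%N >-> (a < b)%N}, Om q, d p q <= r &
          (fun k => d (u (phi k)) q) @ \oo --> 0].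

Definition dF_geodesic : Prop :=
  forall x y, Om x -> Om y -> exists sigma : R -> Cn,
    [/\ sigma 0 = x, sigma (d x y) = y &
        forall s t, 0 <= s <= d x y -> 0 <= t <= d x y ->
          Om (sigma s) /\ d (sigma s) (sigma t) = `|s - t|].

Definition gromov_prod (x y w : Cn) : R := (d x w + d y w - d x y) / 2.

Definition gromov_hyperbolic : Prop :=
  [/\ dF_separates, dF_proper, dF_geodesic &
      exists delta0 : R, 0 <= delta0 /\
        forall x y z w, Om x -> Om y -> Om z -> Om w ->
          gromov_prod x y w >= Num.min (gromov_prod x z w) (gromov_prod z y w) - delta0].

Definition quasi_geodesic (lam : R) (g : R -> Cn) (a b : R) : Prop :=
  (forall t, a <= t <= b -> Om (g t)) /\
  forall s t, a <= s <= b -> a <= t <= b ->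
    lam^-1 * `|t - s| <= d (g t) (g s) <= lam * `|t - s|.
End Metric.

Definition poly_len (g : R -> Cn) (p : seq R) : R :=
  \sum_(i < (size p).-1) enorm (g (nth 0 p i.+1) - g (nth 0 p i)).

Definition euclid_length (g : R -> Cn) (a b : R) : R :=
  sup [set poly_len g (a :: s) | s in [set s | path <%R a s /\ last a s = b]].

End Finsler.

(* Main.v *)
(** Write [d] for the Finsler distance and [S] for a [lam]-quasi-geodesic from [x] to [y].
    Gromov hyperbolicity enters only through stability of quasi-geodesics in the form
    [d x z + d z y <= d x y + M] for every [z] on [S].  It yields an exponential decay: along
    [S] the function [d x] grows, up to a bounded error, at least linearly with slope [1/lam].
    The logarithmic lower bound gives [delta z <= delta x * exp ((d x z + C1) / alpha)], and
    the same with [y].  The lower bound on [F] turns into a Euclidean speed of at most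
    [const * delta ^ beta] on [S], so the Euclidean length of each of the two parts of [S] cut
    at a point [c] is dominated by a geometric integral, hence by its value at [c].  Taking
    [c] where the two bounds on [delta c] agree, both values are comparable to
    [(sqrt (delta x * delta y) * exp (d x y / (2 * alpha))) ^ beta].

    The triangle inequality for [d] is only needed up to an additive constant, and this much
    follows from the four-point condition by letting two of the points coincide. *)

Require Import Defs.
From mathcomp Require Import all_boot all_order all_algebra.
From mathcomp Require Import all_classical all_reals all_analysis measurable_realfun.
From mathcomp Require Import ring lra.
Set Implicit Arguments. Unset Strict Implicit. Unset Printing Implicit Defensive.
Import Order.TTheory GRing.Theory Num.Theory numFieldNormedType.Exports.
Local Open Scope classical_set_scope.
Local Open Scope ring_scope.

(** * Two elementary facts about real numbers *)

(** A discrete substitute for the intermediate value theorem: walk from [a] to [b] through the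
    points [a + i] capped at [b]. The first step that leaves [P] lands in [Q]; if no step leaves
    [P], the point [b] lies in both. *)
Lemma unit_step_crossing (R : realType) (P Q : R -> Prop) (a b : R) :
  a <= b -> (forall t, a <= t <= b -> P t \/ Q t) -> P a -> Q b ->
  exists s t, [/\ a <= s <= b, a <= t <= b, `|s - t| <= 1, P s & Q t].
Proof.
move=> ab PQ Pa Qb; pose u (i : nat) : R := Num.min (a + i%:R) b.
have uab i : a <= u i <= b.
  by rewrite /u le_min ge_min lexx ab lerDl ler0n orbT.
have uS i : `|u i - u i.+1| <= 1.
  rewrite /u -natr1; set k : R := i%:R.
  by have [h1|h1] := leP (a + k) b; have [h2|h2] := leP (a + (k + 1)) b;
    rewrite ler_norml; apply/andP; split; lra.
pose X := exists s t, [/\ a <= s <= b, a <= t <= b, `|s - t| <= 1, P s & Q t].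
rewrite -/X; have step i : X \/ P (u i).
  elim: i => [|i [|Pi]]; [|by left|].
    by right; rewrite /u addr0 min_l.
  have [|Qi] := PQ _ (uab i.+1); first by right.
  by left; exists (u i), (u i.+1); split.
have [//|] := step (Num.truncn (b - a)).+1.
have -> : u (Num.truncn (b - a)).+1 = b.
  by rewrite /u min_r // -lerBlDl ltW // truncnS_gt.
by move=> Pb; exists b, b; rewrite subrr normr0 ler01 ab lexx; split.
Qed.

(** Up to a factor at least 1, [2 ^+ k] is the square of [2 ^+ k./2]; one factor absorbs [2 * B],
    the other half of [k.+1]. *)
Lemma exp2_ge_linear (R : realType) (B : R) :
  exists k0 : nat, forall k, (k0 <= k)%N -> B * k.+1%:R <= 2 ^+ k.
Proof.
pose m := (Num.truncn (2 * `|B|)).+1; exists m.*2 => k mk.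
have mk2 : (m <= k./2)%N by rewrite -(doubleK m) half_leq.
have pow j : (j.+1%:R : R) <= 2 ^+ j by rewrite -natrX ler_nat ltn_expl.
have Bj : 2 * `|B| <= 2 ^+ k./2.
  apply: le_trans (pow _); apply/ltW/(lt_le_trans (truncnS_gt _)).
  by rewrite ler_nat ltnW.
have kj : (k.+1%:R : R) <= 2 * 2 ^+ k./2.
  rewrite (le_trans _ (ler_wpM2l _ (pow _))) // -natrM ler_nat.
  rewrite mul2n doubleS ltnS -[leqLHS]odd_double_half.
  by case: (odd k); rewrite ?add1n ?add0n.
have -> : (2 : R) ^+ k = 2 ^+ (odd k) * (2 ^+ k./2 * 2 ^+ k./2).
  by rewrite -!exprD addnn odd_double_half.
have j0 : 0 <= (2 : R) ^+ k./2 by rewrite exprn_ge0.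
have o1 : 1 <= (2 : R) ^+ (odd k) by rewrite exprn_ege1 // ler1n.
have BB : B <= `|B| by rewrite ler_norm.
have k0 : 0 <= (k.+1%:R : R) by [].
nra.
Qed.

(** * Stability of quasi-geodesics under the four-point condition *)

Section CoarseHyperbolic.
Variables (R : realType) (T : Type) (Om : set T) (d : T -> T -> R) (del : R).
Local Notation gprod x y w := ((d x w + d y w - d x y) / 2).
Hypotheses (del0 : 0 <= del) (d0 : forall x y, 0 <= d x y)
  (dxx : forall x, Om x -> d x x = 0)
  (dC : forall {x y}, Om x -> Om y -> d x y = d y x)
  (dhyp : forall {x y z w}, Om x -> Om y -> Om z -> Om w ->
    Num.min (gprod x z w) (gprod z y w) - del <= gprod x y w)
  (dgeo : forall {x y}, Om x -> Om y -> exists sigma : R -> T,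
    [/\ sigma 0 = x, sigma (d x y) = y &
        forall s t : R, 0 <= s <= d x y -> 0 <= t <= d x y ->
          Om (sigma s) /\ d (sigma s) (sigma t) = `|s - t|]).

Lemma le_gprod_trans m x y z w : Om x -> Om y -> Om z -> Om w ->
  m <= gprod x z w -> m <= gprod z y w -> m - del <= gprod x y w.
Proof.
move=> ox oy oz ow mx my; apply: le_trans (dhyp ox oy oz ow).
by rewrite lerD2r le_min mx.
Qed.

(** With base point [z] both products inside the minimum of the four-point condition vanish. *)
Lemma coarse_triangle x y z : Om x -> Om y -> Om z ->
  d x y <= d x z + d z y + 2 * del.
Proof.
move=> ox oy oz; have := le_gprod_trans (m := 0) ox oy oz oz.
rewrite dxx // (dC oz oy) => H; have := H ltac:(lra) ltac:(lra); lra.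
Qed.

Lemma gprodC x y w : Om x -> Om y -> gprod x y w = gprod y x w.
Proof. by move=> ox oy; rewrite (dC ox oy) [d x w + _]addrC. Qed.

Lemma gprod_chain4 x y z t w : Om x -> Om y -> Om z -> Om t -> Om w ->
  forall m, m <= gprod x y w -> m <= gprod y z w -> m <= gprod z t w ->
  m - 2 * del <= gprod x t w.
Proof.
move=> ox oy oz ot ow m mxy myz mzt.
have := le_gprod_trans oy ot oz ow myz mzt.
have : m - del <= gprod x y w by apply: le_trans mxy; rewrite gerBl.
move=> h1 h2; have := le_gprod_trans ox ot oy ow h1 h2; lra.
Qed.

Section QuasiGeodesic.
Variables (lam : R).
Hypothesis lam1 : 1 <= lam.

(** This is [quasi_geodesic] for an abstract distance; for [dF Om F] both unfold to the same
    statement. *)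
Definition lam_quasi_geodesic (g : R -> T) (a b : R) :=
  (forall t, a <= t <= b -> Om (g t)) /\
  forall s t, a <= s <= b -> a <= t <= b ->
    lam^-1 * `|t - s| <= d (g t) (g s) <= lam * `|t - s|.

Lemma quasi_geodesic_param_le g a b s t : lam_quasi_geodesic g a b ->
  a <= s <= b -> a <= t <= b -> `|t - s| <= lam * d (g t) (g s).
Proof.
move=> [_ qg] sab tab; have /andP[+ _] := qg _ _ sab tab.
by rewrite ler_pdivrMl // (lt_le_trans ltr01).
Qed.

(** Bisection of the parameter interval: each halving costs one [del], and on intervals of length at
    most 1 the product is at least [E - lam / 2]. A curve avoiding the ball of radius [E] about [p]
    thus loses only logarithmically in its length. *)
Lemma gprod_quasi_geodesic g a b p (E : R) (k : nat) : Om p ->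
  lam_quasi_geodesic g a b ->
  (forall t, a <= t <= b -> E <= d p (g t)) ->
  forall s t, a <= s <= b -> a <= t <= b -> `|t - s| <= 2 ^+ k ->
  E - lam / 2 - k%:R * del <= gprod (g s) (g t) p.
Proof.
move=> op [og qg] far; elim: k => [|k IH] s t sab tab.
  rewrite expr0 => st1; have /andP[_ dst] := qg _ _ tab sab.
  have := far _ sab; have := far _ tab.
  rewrite (dC op (og _ sab)) (dC op (og _ tab)) distrC in dst *.
  have : lam * `|t - s| <= lam by rewrite ler_piMr // (le_trans ler01).
  lra.
rewrite exprS => st; pose m := (s + t) / 2.
have mab : a <= m <= b by rewrite /m; lra.
have ms : `|m - s| <= 2 ^+ k.
  have -> : m - s = (t - s) / 2 by rewrite /m; field.
  by rewrite normrM [`|2^-1|]ger0_norm //; lra.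
have tm : `|t - m| <= 2 ^+ k.
  have -> : t - m = (t - s) / 2 by rewrite /m; field.
  by rewrite normrM [`|2^-1|]ger0_norm //; lra.
have := le_gprod_trans (og _ sab) (og _ tab) (og _ mab) op
  (IH _ _ sab mab ms) (IH _ _ mab tab tm).
by rewrite -natr1; lra.
Qed.

Section Stability.
Variables (g : R -> T) (a b : R) (sigma : R -> T).
Hypotheses (ab : a <= b) (qg : lam_quasi_geodesic g a b)
  (sigma0 : sigma 0 = g a) (sigmaD : sigma (d (g a) (g b)) = g b)
  (sigmaP : forall s t : R, 0 <= s <= d (g a) (g b) -> 0 <= t <= d (g a) (g b) ->
    Om (sigma s) /\ d (sigma s) (sigma t) = `|s - t|).
Local Notation D := (d (g a) (g b)).
Local Notation geodesic_within E := (forall u : R, 0 <= u <= D ->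
  exists2 t, a <= t <= b & d (sigma u) (g t) <= E).

(* If [sigma u0] were far from [g], the detour along [g] between points close to
   [sigma (u0 - 2 E)] and [sigma (u0 + 2 E)] would avoid the ball of radius [E - 1] about
   [sigma u0] with length only linear in [E], whereas hyperbolicity requires exponential
   length. *)
Lemma geodesic_within_improve (E : R) (k : nat) : 1 <= E ->
  lam * (6 * E + 4 * del) <= 2 ^+ k -> 1 + lam / 2 + (k%:R + 2) * del < E ->
  geodesic_within E -> geodesic_within (E - 1).
Proof.
move: lam1 del0 => l1 e0 E1 Ek Ebig near u0 u0D; apply: contrapT => notnear.
have far t : a <= t <= b -> E - 1 <= d (sigma u0) (g t).
  by move=> tab; rewrite leNgt; apply/negP => /ltW h; apply: notnear; exists t.
have og := qg.1; have D0 : 0 <= D by [].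
have aab : a <= a <= b by rewrite lexx.
have bab : a <= b <= b by rewrite lexx andbT.
have op : Om (sigma u0) by have [] := sigmaP u0D u0D.
(* Step back [2 * E] along [sigma], then jump by at most [E] to [g]: the product is at least
   [(2 * E + (E - 1) - E) / 2]. If [sigma] starts earlier, its initial point lies on [g] and serves
   for both. *)
have dwn : exists u s : R, [/\ 0 <= u <= u0 /\ u0 - u <= 2 * E, a <= s <= b,
    d (sigma u) (g s) <= E & E - 1 <= gprod (sigma u) (g s) (sigma u0)].
  have [h|h] := leP u0 (2 * E).
    exists 0, a; rewrite sigma0 (dxx (og _ aab)) lexx subr0; split => //; [lra|lra|].
    by have := far _ aab; rewrite (dC op (og _ aab)); lra.
  have uD : 0 <= u0 - 2 * E <= D by lra.
  have [s sab ds] := near _ uD.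
  exists (u0 - 2 * E), s; split => //; first by split; lra.
  have [ ou ->] := sigmaP uD u0D; rewrite (dC (og _ sab) op).
  have -> : u0 - 2 * E - u0 = - (2 * E) by lra.
  have := far _ sab; rewrite normrN ger0_norm; lra.
have upp : exists u s : R, [/\ u0 <= u <= D /\ u - u0 <= 2 * E, a <= s <= b,
    d (sigma u) (g s) <= E & E - 1 <= gprod (sigma u) (g s) (sigma u0)].
  have [h|h] := leP D (u0 + 2 * E).
    exists D, b; rewrite sigmaD (dxx (og _ bab)); split => //; [lra|lra|].
    by have := far _ bab; rewrite (dC op (og _ bab)); lra.
  have uD : 0 <= u0 + 2 * E <= D by lra.
  have [s sab ds] := near _ uD.
  exists (u0 + 2 * E), s; split => //; first by split; lra.
  have [ ou ->] := sigmaP uD u0D; rewrite (dC (og _ sab) op).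
  have -> : u0 + 2 * E - u0 = 2 * E by lra.
  have := far _ sab; rewrite ger0_norm; lra.
have [u1 [s1 [[u1D u1E] s1ab ds1 ps1]]] := dwn.
have [u2 [s2 [[u2D u2E] s2ab ds2 ps2]]] := upp.
have u1D' : 0 <= u1 <= D by lra.
have u2D' : 0 <= u2 <= D by lra.
have [ o1 d12] := sigmaP u1D' u2D'; have [ o2 _] := sigmaP u2D' u1D'.
have [_ d1p] := sigmaP u1D' u0D; have [_ d2p] := sigmaP u2D' u0D.
rewrite ler0_norm in d12; last lra.
rewrite ler0_norm in d1p; last lra.
rewrite ger0_norm in d2p; last lra.
have og1 := og _ s1ab; have og2 := og _ s2ab.
have dgg : d (g s2) (g s1) <= 6 * E + 4 * del.
  rewrite (dC og2 og1).
  have := coarse_triangle og1 og2 o1; have := coarse_triangle o1 og2 o2.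
  by rewrite (dC og1 o1); lra.
have s12 : `|s2 - s1| <= 2 ^+ k.
  apply: le_trans (quasi_geodesic_param_le qg s1ab s2ab) _.
  by apply: le_trans Ek; rewrite ler_pM2l // (lt_le_trans ltr01).
have gg := gprod_quasi_geodesic op qg far s1ab s2ab s12.
have kd : 0 <= k%:R * del by rewrite mulr_ge0.
(* The product of [sigma u1] and [sigma u2] at [sigma u0] is 0, because [sigma u0] lies between them
   on a geodesic; the chain makes it positive by [Ebig]. *)
have := gprod_chain4 o1 og1 og2 o2 op (m := E - 1 - lam / 2 - k%:R * del).
rewrite (gprodC _ og2 o2) => H.
have := H ltac:(lra) ltac:(lra) ltac:(lra); lra.
Qed.

(** Each application of the hypothesis lowers the radius by 1, so finitely many reach a bound
    independent of the initial [E]. *)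
Lemma geodesic_within_descend (E0 E : R) :
  (forall E', E0 < E' -> geodesic_within E' -> geodesic_within (E' - 1)) ->
  geodesic_within E -> geodesic_within (E0 + 1).
Proof.
move=> imp nearE.
have mono E1 E2 : E1 <= E2 -> geodesic_within E1 -> geodesic_within E2.
  by move=> h near u /near[t tab dt]; exists t => //; apply: le_trans h.
have desc (i : nat) : geodesic_within E -> E <= E0 + i%:R -> geodesic_within (E0 + 1).
  elim: i E {nearE} => [|i IH] E nearE; first by move=> h; apply: mono nearE; lra.
  rewrite -natr1 => h; have [h1|h1] := leP E E0; first by apply: mono nearE; lra.
  by apply: (IH (E - 1)); [exact: imp|lra].
apply: (desc (Num.truncn (E - E0)).+1 nearE).
by rewrite -lerBlDl ltW // truncnS_gt.
Qed.

(** A crude radius, depending on the curve, from which the descent starts. *)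
Lemma geodesic_within_start : geodesic_within D.
Proof.
move: ab => aleb u uD; have D0 : 0 <= D by [].
have z0 : 0 <= (0 : R) <= D by lra.
exists a; first lra.
have [_] := sigmaP uD z0; rewrite sigma0 => ->.
by rewrite subr0 ger0_norm; lra.
Qed.

(** Each point of [sigma] is close to [g] before or after time [t], so two points of [sigma] at
    distance at most 1 are close to [g s1] and [g s2] with [s1 <= t <= s2]. The quasi-geodesic bound
    makes [s2 - s1] bounded, which puts [g t] near [sigma], where distances to the ends add up
    exactly. *)
Lemma quasi_geodesic_near_geodesic (E t : R) : 0 <= E -> geodesic_within E -> a <= t <= b ->
  d (g a) (g t) + d (g t) (g b)
    <= D + 2 * (lam * (lam * (2 * E + 1 + 4 * del)) + E + 4 * del).
Proof.
move: ab lam1 del0 => aleb l1 e0 E0 near tab; have og := qg.1; have ogt := og _ tab.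
have aab : a <= a <= b by rewrite lexx.
have bab : a <= b <= b by rewrite lexx andbT.
have oa := og _ aab; have ob := og _ bab.
pose P u := exists2 s, a <= s <= t & d (sigma u) (g s) <= E.
pose Q u := exists2 s, t <= s <= b & d (sigma u) (g s) <= E.
have [u| | |u1 [u2 [u1D u2D u12 [s1 s1t d1] [s2 s2t d2]]]] :=
  @unit_step_crossing _ P Q 0 D (d0 _ _).
- move=> /near[s sab ds]; have [st|st] := leP s t.
    by left; exists s => //; lra.
  by right; exists s => //; lra.
- by exists a; rewrite ?sigma0 ?dxx //; lra.
- by exists b; rewrite ?sigmaD ?dxx //; lra.
have s1ab : a <= s1 <= b by lra.
have s2ab : a <= s2 <= b by lra.
have [ o1 dd12] := sigmaP u1D u2D; have [ o2 _] := sigmaP u2D u1D.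
have og1 := og _ s1ab; have og2 := og _ s2ab.
have d12 : d (g s2) (g s1) <= 2 * E + 1 + 4 * del.
  rewrite (dC og2 og1).
  have := coarse_triangle og1 og2 o1; have := coarse_triangle o1 og2 o2.
  by rewrite (dC og1 o1); lra.
have lam0 : 0 < lam by lra.
have st : `|t - s1| <= lam * (2 * E + 1 + 4 * del).
  rewrite -(ler_pM2l lam0) in d12.
  apply: le_trans d12; apply: le_trans (quasi_geodesic_param_le qg s1ab s2ab).
  by rewrite !ger0_norm; lra.
rewrite -(ler_pM2l lam0) in st.
have /andP[_ d1t] := qg.2 _ _ s1ab tab.
have D0 : 0 <= D by [].
have zD : 0 <= (0 : R) <= D by lra.
have DD : 0 <= D <= D by lra.
have [_] := sigmaP u1D DD; have [_] := sigmaP u1D zD.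
rewrite sigma0 sigmaD => da db.
rewrite ger0_norm in da; last lra.
rewrite ler0_norm in db; last lra.
have := coarse_triangle o1 ogt og1; have := coarse_triangle oa ogt o1.
have := coarse_triangle ogt ob o1.
rewrite (dC oa o1) (dC ogt o1) (dC og1 ogt); lra.
Qed.

End Stability.

Lemma quasi_geodesic_stability : exists2 M, 0 <= M &
  forall g a b t, lam_quasi_geodesic g a b -> a <= t <= b ->
    d (g a) (g t) + d (g t) (g b) <= d (g a) (g b) + M.
Proof.
move: lam1 del0 => l1 e0; have lam0 : 0 < lam by lra.
pose A := 2 + lam / 2 + 2 * del.
pose c := lam * (6 + 4 * del).
have [k0 k0P] := exp2_ge_linear (c * (A + (del + 1))).
pose E0 := A + k0.+1%:R * (del + 1).
have A1 : 1 <= A by rewrite /A; lra.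
have c0 : 0 <= c by rewrite mulr_ge0 ?(ltW lam0) //; lra.
have k0del : 0 <= k0.+1%:R * (del + 1) by rewrite mulr_ge0 //; lra.
have E00 : 1 <= E0 + 1 by rewrite /E0; lra.
exists (2 * (lam * (lam * (2 * (E0 + 1) + 1 + 4 * del)) + (E0 + 1) + 4 * del)).
  have e1 : 0 <= 2 * (E0 + 1) + 1 + 4 * del by lra.
  have := mulr_ge0 (ltW lam0) (mulr_ge0 (ltW lam0) e1); lra.
move=> g a b t qg tab; have ab : a <= b by lra.
have oa : Om (g a) by apply: qg.1; rewrite lexx.
have ob : Om (g b) by apply: qg.1; rewrite lexx andbT.
have [sigma [s0 sD sP]] := dgeo oa ob.
apply: (quasi_geodesic_near_geodesic ab qg s0 sD sP) tab; first lra.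
apply: geodesic_within_descend; last exact: (geodesic_within_start ab s0 sP).
(* [k] is chosen with [A + k * (del + 1) <= E < A + (k + 1) * (del + 1)]. The lower bound gives the
   room required by [geodesic_within_improve]; the upper one keeps the detour length linear in [k],
   hence below [2 ^+ k]. Using [del + 1] keeps the divisor positive. *)
move=> E EE0; pose k := Num.truncn ((E - A) / (del + 1)).
have del1 : 0 < del + 1 by lra.
have x0 : 0 <= (E - A) / (del + 1).
  rewrite divr_ge0 ?(ltW del1) // subr_ge0 (le_trans _ (ltW EE0)) // lerDl.
  by rewrite mulr_ge0 // ltW.
have /andP[kl ku] := truncn_itv x0; rewrite -/k in kl ku.
rewrite ler_pdivlMr // in kl; rewrite ltr_pdivrMr // in ku.
have k0k : (k0 <= k)%N.
  rewrite -ltnS -(ltr_nat R) -(ltr_pM2r del1).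
  apply: le_lt_trans ku; rewrite lerBrDl ltW //.
  by apply: le_lt_trans EE0; rewrite lerD2l ler_pM2r // ler_nat leqnSn.
have := k0P _ k0k; set K := 2 ^+ k => cK.
have kn : 0 <= k%:R :> R by [].
have kE : 1 + lam / 2 + (k%:R + 2) * del < E by rewrite /A in kl; nra.
apply: (@geodesic_within_improve _ _ _ _ ab qg s0 sD sP E k) => //.
  rewrite /A in kl; nra.
apply: le_trans cK; rewrite -/K.
have E1 : 1 <= E by nra.
have : lam * (6 * E + 4 * del) <= c * E by rewrite /c -mulrA ler_pM2l //; nra.
move=> /le_trans; apply; rewrite -mulrA ler_wpM2l //.
rewrite -natr1 in ku *; nra.
Qed.

End QuasiGeodesic.
End CoarseHyperbolic.

(** * Increments along piecewise C1 curves bounded by integrals *)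

(** The integral of a nonnegative function is a supremum over simple functions below it, which is
    monotone for arbitrary functions. This is applied to the integrand of [F_length]. *)
Lemma ge0_le_integral_nonmeasurable d (T : measurableType d) (R : realType)
    (mu : {measure set T -> \bar R}) (D : set T) (f1 f2 : T -> \bar R) :
  (forall x, D x -> (0 <= f1 x)%E) -> (forall x, D x -> (f1 x <= f2 x)%E) ->
  (\int[mu]_(x in D) f1 x <= \int[mu]_(x in D) f2 x)%E.
Proof.
move=> f0 f12; have f20 x : D x -> (0 <= f2 x)%E.
  by move=> Dx; apply: le_trans (f12 x Dx); exact: f0.
rewrite !ge0_integralE //; apply: le_ereal_sup => _ [h /= hf <-].
exists h => // x; apply: le_trans (hf x) _.
by rewrite !patchE; case: ifPn => // /set_mem /f12.
Qed.

(** [f] is controlled only inside the interval, as the derivative of a piecewise C1 curve is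
    arbitrary at break points. The fundamental theorem of calculus is used on compact subintervals,
    whose ends then tend to [t] and [u] by continuity of [h]. *)
Lemma increment_le_integral_piece (R : realType) (h f : R -> R) (t u : R) :
  t < u -> {within `[t, u], continuous h} ->
  (forall x, t < x < u -> is_derive x 1 h (f x)) ->
  (forall x, t < x < u -> {for x, continuous f}) ->
  measurable_fun `[t, u] f /\
  ((h u - h t)%:E <= \int[lebesgue_measure]_(x in `[t, u]) `|f x|%:E)%E.
Proof.
move=> tu hc hd fc.
have mf : measurable_fun `[t, u] f.
  apply/measurable_fun_itv_bndo_bndcP/measurable_fun_itv_obnd_cbndP.
  apply: open_continuous_measurable_fun; first exact: interval_open.
  by move=> x; rewrite inE /= in_itv /= => /fc.
have mnf (a b : R) : t <= a -> b <= u ->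
    measurable_fun `[a, b] (fun x => `|f x|%:E).
  move=> ta bu; apply/measurable_EFinP/measurableT_comp => //.
  by apply: measurable_funS mf => // x; rewrite /= !in_itv /= => xab; lra.
split=> //; set I := (\int[_]_(x in _) _)%E.
have inner a b : t < a -> a < b -> b < u -> ((h b - h a)%:E <= I)%E.
  move=> ta ab bu; have tc x : a <= x <= b -> t < x < u by lra.
  have hcont x : t < x < u -> {for x, continuous h}.
    by move=> /hd [dx _]; apply: differentiable_continuous; apply/derivable1_diffP.
  rewrite EFinB -(@continuous_FTC2 _ f h a b) //; last 3 first.
  - by apply: continuous_in_subspaceT => x; rewrite inE /= in_itv /= => /tc /fc.
  - split.
    + by move=> x; rewrite in_itv /= => xab; have [] := hd x ltac:(lra).
    + by apply: cvg_at_right_filter; apply: hcont; lra.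
    + by apply: cvg_at_left_filter; apply: hcont; lra.
  - by move=> x; rewrite in_itv /= => xab; rewrite derive1E; have [] := hd x ltac:(lra).
  apply: (@le_trans _ _ (\int[lebesgue_measure]_(x in `[a, b]) `|f x|%:E)%E).
    apply: le_trans (lee_abs _) _.
    apply: le_trans (le_abse_integral _ _ _) _ => //.
    apply/measurable_EFinP; apply: measurable_funS mf => // x.
    by rewrite /= !in_itv /= => xab; lra.
  apply: ge0_subset_integral => //; first exact: mnf.
  by move=> x; rewrite /= !in_itv /= => xab; lra.
have [_ hct hcu] := (continuous_within_itvP h tu).1 hc.
have [m /andP[tm mu]] : exists m, t < m < u by exists ((t + u) / 2); lra.
case: I inner => [r| |] inner; last 2 first.
- by rewrite leey.
- have := inner ((t + m) / 2) ((m + u) / 2) ltac:(lra) ltac:(lra) ltac:(lra).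
  by rewrite leNgt ltNye.
rewrite lee_fin; apply/ler_addgt0Pr => e e0.
have e2 : 0 < e / 2 by rewrite divr_gt0.
have [a []] : exists a, [/\ t < a, a < m & `|h t - h a| < e / 2].
  apply: (@filter_ex _ (t^'+)); near=> a; split; near: a.
  - exact: nbhs_right_gt.
  - exact: nbhs_right_lt.
  - by move/cvgrPdist_lt : hct; apply.
rewrite ltr_norml => ta am /andP[ha1 ha2].
have [b []] : exists b, [/\ m < b, b < u & `|h u - h b| < e / 2].
  apply: (@filter_ex _ (u^'-)); near=> b; split; near: b.
  - exact: nbhs_left_gt.
  - exact: nbhs_left_lt.
  - by move/cvgrPdist_lt : hcu; apply.
rewrite ltr_norml => mb bu /andP[hb1 hb2].
have := inner a b ta (lt_trans am mb) bu; rewrite lee_fin; lra.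
Unshelve. all: by end_near. Qed.

Lemma le_last_path (R : realType) (a : R) s : path <%R a s -> a <= last a s.
Proof.
elim: s a => //= u s IH a /andP[au /IH us].
exact: le_trans (ltW au) us.
Qed.

(** Measurability is carried through the induction for the additivity of the integral over the
    pieces. *)
Lemma increment_le_integral_path (R : realType) (h f : R -> R) (s : seq R) (a : R) :
  path <%R a s -> {within `[a, last a s], continuous h} ->
  (forall i, (i < size s)%N -> forall x, nth 0 (a :: s) i < x < nth 0 s i ->
    is_derive x 1 h (f x) /\ {for x, continuous f}) ->
  measurable_fun `[a, last a s] f /\
  ((h (last a s) - h a)%:E <=
    \int[lebesgue_measure]_(x in `[a, last a s]) `|f x|%:E)%E.
Proof.
elim: s a => [|u s IH] a /=.
  move=> _ _ _; rewrite set_itv1; split; first exact: measurable_fun_set1.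
  by rewrite integral_set1 subrr.
move=> /andP[au us] hc hf; have ul := le_last_path us.
set l := last u s in hc ul *.
have [||m2 i2] := IH u us.
- apply: continuous_subspaceW hc => x; rewrite /= !in_itv /= => /andP[ux ->].
  by rewrite (le_trans (ltW au) ux).
- by move=> i i_s; apply: (hf i.+1).
have [|x /(hf 0%N isT) []//|x /(hf 0%N isT) []//|m1 i1] :=
  @increment_le_integral_piece _ h f a u au.
  apply: continuous_subspaceW hc => x; rewrite /= !in_itv /= => /andP[-> xu].
  exact: le_trans xu ul.
have splitE : `[a, l]%classic = `[a, u[%classic `|` `[u, l]%classic.
  apply/seteqP; split=> x /=; rewrite !in_itv /=.
    by move=> /andP[ax xl]; have [xu|xu] := ltP x u; [left|right]; rewrite ?ax ?xl.
  by case=> /andP[x1 x2]; apply/andP; split; lra.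
have m1' : measurable_fun `[a, u[ f by apply/measurable_fun_itv_bndo_bndcP.
have mf : measurable_fun `[a, l] f.
  by rewrite splitE; apply/measurable_funU => //; split.
split=> //; have -> : h l - h a = (h u - h a) + (h l - h u) by ring.
rewrite EFinD splitE ge0_integral_setU //=; last 2 first.
- by rewrite -splitE; apply/measurable_EFinP/measurableT_comp.
- apply/disj_setPS => x [] /=; rewrite !in_itv /= => /andP[_ xu] /andP[ux _].
  by move: xu; rewrite ltNge ux.
apply: leeD => //.
by rewrite integral_itv_bndo_bndc //; apply/measurable_EFinP/measurableT_comp.
Qed.

(** * The Euclidean norm on [Cn] *)

Section EuclideanNorm.
Variables (R : realType) (n : nat).
Implicit Types z w : Cn R n.

(** The real part of the Hermitian inner product, that is the inner product of the underlying real
    space of dimension [2 n]. *)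
Definition edot z w : R := \sum_(i < n) (z.1 ord0 i * w.1 ord0 i + z.2 ord0 i * w.2 ord0 i).

Lemma edot_ge0 z : 0 <= edot z z.
Proof. by apply: sumr_ge0 => i _; rewrite addr_ge0 // -expr2 sqr_ge0. Qed.

Lemma enormE z : enorm z = Num.sqrt (edot z z).
Proof. by congr Num.sqrt; apply: eq_bigr => i _; rewrite !expr2. Qed.

Lemma enorm_ge0 z : 0 <= enorm z. Proof. exact: sqrtr_ge0. Qed.

Lemma sqr_enorm z : enorm z ^+ 2 = edot z z.
Proof. by rewrite enormE sqr_sqrtr // edot_ge0. Qed.

Lemma edotC z w : edot z w = edot w z.
Proof. by apply: eq_bigr => i _; ring. Qed.

Lemma edotDl z z' w : edot (z + z') w = edot z w + edot z' w.
Proof. by rewrite -big_split; apply: eq_bigr => i _ /=; rewrite !mxE; ring. Qed.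

Lemma edotZl c z w : edot (c *: z) w = c * edot z w.
Proof. by rewrite mulr_sumr; apply: eq_bigr => i _ /=; rewrite !mxE; ring. Qed.

Lemma enormN z : enorm (- z) = enorm z.
Proof. by rewrite !enormE; congr Num.sqrt; apply: eq_bigr => i _ /=; rewrite !mxE; ring. Qed.

Lemma enorm_distC z w : enorm (z - w) = enorm (w - z).
Proof. by rewrite -enormN opprB. Qed.

Lemma enorm0 : enorm (0 : Cn R n) = 0.
Proof.
by rewrite enormE /edot big1 ?sqrtr0 // => i _; rewrite !mxE !mul0r addr0.
Qed.

Lemma enorm_eq0 z : enorm z = 0 -> z = 0.
Proof.
move=> z0; have /eqP : edot z z = 0 by rewrite -sqr_enorm z0 expr0n.
rewrite psumr_eq0; last by move=> i _; rewrite addr_ge0 // -expr2 sqr_ge0.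
move=> /allP /= zi; have {}zi i : z.1 ord0 i = 0 /\ z.2 ord0 i = 0.
  have := zi i; rewrite mem_index_enum => /(_ isT).
  rewrite -!expr2 paddr_eq0 ?sqr_ge0 // !sqrf_eq0 => /andP[/eqP -> /eqP ->] //.
case: z zi {z0} => z1 z2 /= zi; congr pair; apply/rowP => i; rewrite mxE.
  by rewrite (zi i).1.
by rewrite (zi i).2.
Qed.

(** Cauchy-Schwarz, by expanding the square of [edot z w *: z - enorm z ^+ 2 *: w]. *)
Lemma edot_le_enorm z w : edot z w <= enorm z * enorm w.
Proof.
have [z0|z0] := eqVneq (enorm z) 0.
  by rewrite (enorm_eq0 z0) enorm0 mul0r /edot big1 // => i _; rewrite !mxE !mul0r addr0.
have zp : 0 < enorm z ^+ 2 by rewrite exprn_gt0 // lt_def z0 enorm_ge0.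
have := edot_ge0 (edot z w *: z - enorm z ^+ 2 *: w).
rewrite edotDl edotC [edot (- _) _]edotC !edotDl -scaleNr !edotZl.
rewrite -!(edotC (_ *: _)) !edotZl (edotC w z) -!sqr_enorm => H.
have {}H : edot z w ^+ 2 <= (enorm z * enorm w) ^+ 2.
  rewrite -(ler_pM2l zp) exprMn; nra.
apply: le_trans (ler_norm _) _.
by rewrite -(@ler_pXn2r _ 2) // ?nnegrE ?mulr_ge0 ?enorm_ge0 // -normrX ger0_norm ?sqr_ge0.
Qed.

Lemma edot_norm_le z w : `|edot z w| <= enorm z * enorm w.
Proof.
rewrite ler_norml edot_le_enorm andbT lerNl -(enormN z).
by rewrite -mulN1r -edotZl scaleN1r edot_le_enorm.
Qed.

Lemma enorm_triangle z w : enorm (z + w) <= enorm z + enorm w.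
Proof.
rewrite -(@ler_pXn2r _ 2) // ?nnegrE ?addr_ge0 ?enorm_ge0 //.
rewrite sqr_enorm edotDl !(edotC _ (z + w)) !edotDl -!sqr_enorm (edotC w z).
have := edot_le_enorm z w; nra.
Qed.

Lemma enorm_dist_triangle z w v : enorm (z - v) <= enorm (z - w) + enorm (w - v).
Proof. by have := enorm_triangle (z - w) (w - v); rewrite addrA subrK. Qed.

End EuclideanNorm.

(** * Limits and derivatives through coordinates *)

Section CoordinateCalculus.
Variables (R : realType) (n : nat).

Lemma cvg_coord1 (i : 'I_n) T (G : set_system T) (u : T -> Cn R n) (a : Cn R n) :
  Filter G -> u x @[x --> G] --> a -> (u x).1 ord0 i @[x --> G] --> a.1 ord0 i.
Proof.
move=> FG ua; apply: (@cvg_comp _ _ _ (fun x => (u x).1) (fun M => M ord0 i)).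
  by apply: cvg_comp ua _; exact: cvg_fst.
exact: coord_continuous.
Qed.

Lemma cvg_coord2 (i : 'I_n) T (G : set_system T) (u : T -> Cn R n) (a : Cn R n) :
  Filter G -> u x @[x --> G] --> a -> (u x).2 ord0 i @[x --> G] --> a.2 ord0 i.
Proof.
move=> FG ua; apply: (@cvg_comp _ _ _ (fun x => (u x).2) (fun M => M ord0 i)).
  by apply: cvg_comp ua _; exact: cvg_snd.
exact: coord_continuous.
Qed.

Lemma cvg_edot T (G : set_system T) (u v : T -> Cn R n) (a b : Cn R n) :
  Filter G -> u x @[x --> G] --> a -> v x @[x --> G] --> b ->
  edot (u x) (v x) @[x --> G] --> edot a b.
Proof.
move=> FG ua vb; apply: cvg_big; first exact: add_continuous.
by move=> i _; apply: cvgD; [exact: (cvgM (cvg_coord1 (i := i) _ ua) (cvg_coord1 (i := i) _ vb))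
  |exact: (cvgM (cvg_coord2 (i := i) _ ua) (cvg_coord2 (i := i) _ vb))].
Qed.

(** A continuous linear functional, later a coordinate, commutes with difference quotients and their
    limits. *)
Lemma is_derive_linear_comp (phi : Cn R n -> R) (g : R -> Cn R n) (x : R) :
  (forall c u v, phi (c *: (u - v)) = c * (phi u - phi v)) -> continuous phi ->
  derivable g x 1 -> is_derive x 1 (phi \o g) (phi (derive1 g x)).
Proof.
move=> phiZB phic gx; rewrite derive1E.
have H : (fun h : R => h^-1 *: (((phi \o g) \o shift x) (h *: 1) - (phi \o g) x))
    @ 0^' --> phi ('D_1 g x).
  rewrite [X in X @ _ --> _](_ : _ =
      phi \o (fun h => h^-1 *: ((g \o shift x) (h *: 1) - g x))).
    by apply: cvg_comp gx _; exact: phic.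
  by apply/funext => h /=; rewrite phiZB.
by split; [apply/cvg_ex; exists (phi ('D_1 g x))|apply: cvg_lim].
Qed.

Lemma is_derive_edot_sqr (g : R -> Cn R n) (p : Cn R n) (x : R) :
  derivable g x 1 ->
  is_derive x 1 (fun t => edot (g t - p) (g t - p))
    (2 * edot (g x - p) (derive1 g x)).
Proof.
move=> gx.
have d1 i : is_derive x 1 (fun t => (g t).1 ord0 i) ((derive1 g x).1 ord0 i).
  apply: (@is_derive_linear_comp (fun z => z.1 ord0 i)) gx.
    by move=> c u v; rewrite /= !mxE.
  by move=> z; apply: (@cvg_coord1 i _ (nbhs z) id); exact: cvg_id.
have d2 i : is_derive x 1 (fun t => (g t).2 ord0 i) ((derive1 g x).2 ord0 i).
  apply: (@is_derive_linear_comp (fun z => z.2 ord0 i)) gx.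
    by move=> c u v; rewrite /= !mxE.
  by move=> z; apply: (@cvg_coord2 i _ (nbhs z) id); exact: cvg_id.
pose c1 i := (fun t => (g t).1 ord0 i) - cst (p.1 ord0 i).
pose c2 i := (fun t => (g t).2 ord0 i) - cst (p.2 ord0 i).
have e1 i : is_derive x 1 (c1 i) ((derive1 g x).1 ord0 i).
  rewrite -[X in is_derive _ _ _ X]subr0; apply: is_deriveB.
have e2 i : is_derive x 1 (c2 i) ((derive1 g x).2 ord0 i).
  rewrite -[X in is_derive _ _ _ X]subr0; apply: is_deriveB.
have -> : (fun t => edot (g t - p) (g t - p)) =
    \sum_(i < n) (c1 i * c1 i + c2 i * c2 i).
  by apply/funext => t; rewrite fct_sumE; apply: eq_bigr => i _; rewrite !mxE.
have -> : 2 * edot (g x - p) (derive1 g x) = \sum_(i < n)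
    (c1 i x *: (derive1 g x).1 ord0 i + c1 i x *: (derive1 g x).1 ord0 i +
    (c2 i x *: (derive1 g x).2 ord0 i + c2 i x *: (derive1 g x).2 ord0 i)).
  rewrite mulr_sumr; apply: eq_bigr => i _; rewrite !mxE /c1 /c2 /cst /= /GRing.scale /=.
  by rewrite !fctE; ring.
exact: (is_derive_sum (fun i =>
  is_deriveD (is_deriveM (e1 i) (e1 i)) (is_deriveM (e2 i) (e2 i)))).
Qed.

End CoordinateCalculus.

(** * The distance to the boundary *)

Section BoundaryDistance.
Variables (R : realType) (n : nat) (Om : set (Cn R n)).

Lemma delta_has_lbound z : has_lbound [set enorm (z - w) | w in closure Om `\` Om].
Proof. by exists 0 => _ [w _ <-]; exact: enorm_ge0. Qed.

Lemma delta_le_add z p : delta Om z <= delta Om p + enorm (z - p).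
Proof.
(* With empty boundary [delta] is the infimum of the empty set, which is 0 by convention. *)
have [b0|/set0P[w bw]] := eqVneq (closure Om `\` Om) set0.
  by rewrite /delta b0 !image_set0 inf0 add0r enorm_ge0.
rewrite -lerBlDr; apply: lb_le_inf; first by exists (enorm (p - w)), w.
move=> _ [v bv <-]; rewrite lerBlDr.
apply: le_trans (ge_inf (delta_has_lbound z) _) _; first by exists v.
by rewrite [leRHS]addrC enorm_dist_triangle.
Qed.

(** Balls of [Cn] refer to the sup norm, which is at most [enorm]. *)
Lemma enorm_ball (z : Cn R n) (e : R) : 0 < e ->
  forall w, enorm (z - w) < e -> ball z e w.
Proof.
move=> e0 w; rewrite -{1}(gtr0_norm e0) -sqrtr_sqr enormE ltr_sqrt ?exprn_gt0 // => ze.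
have coord i : (z.1 ord0 i - w.1 ord0 i) ^+ 2 + (z.2 ord0 i - w.2 ord0 i) ^+ 2 < e ^+ 2.
  apply: le_lt_trans ze; rewrite /edot (bigD1 i) //= !mxE !expr2 lerDl.
  by apply: sumr_ge0 => j _; rewrite addr_ge0 // -expr2 sqr_ge0.
have sqe x : x ^+ 2 < e ^+ 2 -> `|x| < e.
  by rewrite -real_normK ?num_real // ltr_pXn2r // nnegrE // ltW.
split; split=> // i j; rewrite ord1 /ball /=; apply: sqe; apply: le_lt_trans (coord j).
  by rewrite lerDl sqr_ge0.
by rewrite lerDr sqr_ge0.
Qed.

Lemma delta_gt0 z : open Om -> Om z -> closure Om `\` Om !=set0 -> 0 < delta Om z.
Proof.
move=> oOm Oz bne; have : nbhs z Om by exact: open_nbhs_nbhs.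
move=> /nbhs_ballP[e /= e0 eOm]; apply: (lt_le_trans e0).
case: bne => v bv; apply: lb_le_inf; first by exists (enorm (z - v)), v.
move=> _ [w [_ nw] <-]; rewrite leNgt; apply/negP => /(enorm_ball e0) /eOm.
exact: nw.
Qed.

Lemma delta_eq0 z : ~ (closure Om `\` Om !=set0) -> delta Om z = 0.
Proof. by move=> /set0P/negP/negPn/eqP b0; rewrite /delta b0 image_set0 inf0. Qed.

End BoundaryDistance.

(** * Local comparison of the Euclidean and the Finsler distance *)

(** Compares the gradient of the potential in [F_length_lower] with the weight [e / (e + rho)]; the
    difference is a combination of even powers with nonnegative coefficients. *)
Lemma rational_weight_le (R : realFieldType) (e rho : R) : 0 < e -> 0 <= rho ->
  e ^+ 3 * rho * (e + rho) <= e * (e ^+ 2 + rho ^+ 2) ^+ 2.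
Proof.
move=> e0 r0; rewrite -subr_ge0.
have -> : e * (e ^+ 2 + rho ^+ 2) ^+ 2 - e ^+ 3 * rho * (e + rho) =
    e * (e ^+ 2 * ((e - rho / 2) ^+ 2 + 3 / 4 * rho ^+ 2) + rho ^+ 4) by field.
rewrite mulr_ge0 ?(ltW e0) // addr_ge0 ?exprn_ge0 // mulr_ge0 ?sqr_ge0 //.
by rewrite addr_ge0 ?sqr_ge0 // mulr_ge0 ?sqr_ge0 // divr_ge0.
Qed.

(** Since [e <= r], [s <= r + rho <= r * ((e + rho) / e)]; the last factor is at least 1, so its
    power [beta < 1] does not exceed it. Here [r] and [s] stand for [delta] at [p] and [z], and
    [rho] for their distance. *)
Lemma powR_weight_le (R : realType) (beta r s rho e x : R) : 0 < beta < 1 ->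
  0 < e <= r -> 0 < s <= r + rho -> 0 <= rho -> 0 <= x ->
  x * e / (r `^ beta * (e + rho)) <= x / s `^ beta.
Proof.
move=> /andP[b0 b1] /andP[e0 er] /andP[s0 sr] rho0 x0.
have r0 : 0 < r := lt_le_trans e0 er.
have rb : 0 < r `^ beta by rewrite powR_gt0.
have sb : 0 < s `^ beta by rewrite powR_gt0.
have erho : 0 < e + rho by rewrite ltr_pwDl.
have h1 : s <= r * ((e + rho) / e).
  apply: le_trans sr _; rewrite mulrA ler_pdivlMr //.
  by rewrite mulrDl mulrDr lerD2l [leLHS]mulrC ler_wpM2r.
have h2 : 1 <= (e + rho) / e by rewrite ler_pdivlMr // mul1r lerDl.
have h3 : 0 <= (e + rho) / e by exact: le_trans ler01 h2.
have h4 : s `^ beta <= r `^ beta * ((e + rho) / e).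
  apply: (@le_trans _ _ ((r * ((e + rho) / e)) `^ beta)).
    by apply: ge0_ler_powR; rewrite ?nnegrE ?(ltW b0) ?(ltW s0) // mulr_ge0 // ltW.
  rewrite (powRM beta (ltW r0) h3) ler_wpM2l ?(ltW rb) //.
  by rewrite -[leRHS]powRr1 // ler_powR // ltW.
rewrite mulrA ler_pdivlMr // in h4.
rewrite -mulrA ler_wpM2l // ler_pdivrMr ?mulr_gt0 // mulrC ler_pdivlMr //.
by rewrite mulrC.
Qed.

Section LocalEstimate.
Variables (R : realType) (n : nat) (Om : set (Cn R n)) (F : Cn R n -> Cn R n -> R).
Variables (C beta : R).
Hypotheses (C0 : 0 < C) (beta01 : 0 < beta < 1)
  (F0 : forall z X, Om z -> 0 <= F z X) (delta0 : forall z, Om z -> 0 < delta Om z)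
  (FC : forall z X, Om z -> X != 0 -> C * enorm X / (delta Om z) `^ beta <= F z X).

(** The bound holds on all of [Om], so a curve need not be cut where it leaves a ball about [p]. *)
Lemma F_lower_ball (p z X : Cn R n) (e : R) : Om p -> Om z -> 0 < e <= delta Om p ->
  C * enorm X * e / (delta Om p `^ beta * (e + enorm (z - p))) <= F z X.
Proof.
move=> op oz /andP[e0 er]; have /andP[b0 b1] := beta01.
have [->|X0] := eqVneq X 0; first by rewrite enorm0 mulr0 !mul0r F0.
apply: le_trans (FC oz X0).
by apply: powR_weight_le; rewrite ?e0 ?delta0 ?enorm_ge0 ?mulr_ge0 ?enorm_ge0 ?(ltW C0) //
  delta_le_add.
Qed.

Lemma F_length_lower (p q : Cn R n) (g : R -> Cn R n) (e : R) :
  Om p -> admissible Om p q g -> 0 < e -> e <= delta Om p -> e <= enorm (p - q) ->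
  ((C / (delta Om p `^ beta) / 4 * e)%:E <= F_length F g)%E.
Proof.
move=> op [[gc [s [s01 s1 sP]]] gOm g0 g1] e0 er epq.
have rb : 0 < delta Om p `^ beta by rewrite powR_gt0 // delta0.
(* [h] is, up to a constant, the potential [K e rho^2 / (e^2 + rho^2)] with
   [rho = enorm (g t - p)]: it is smooth at [p], grows by at least [K e / 2] along [g], and
   its gradient is at most the lower bound of [F_lower_ball]. *)
pose K := C / (delta Om p `^ beta) / 2.
have K0 : 0 < K by rewrite !divr_gt0.
pose Q t := edot (g t - p) (g t - p).
have Q0 t : 0 < e ^+ 2 + Q t by rewrite ltr_pwDl ?exprn_gt0 // edot_ge0.
pose h t := - (K * e ^+ 3) * (e ^+ 2 + Q t)^-1.
pose f t := K * e ^+ 3 * (2 * edot (g t - p) (derive1 g t)) / (e ^+ 2 + Q t) ^+ 2.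
have cvgQ (G : set_system R) (FG : Filter G) t : g x @[x --> G] --> g t ->
    (e ^+ 2 + Q x) @[x --> G] --> e ^+ 2 + Q t.
  move=> gt; apply: cvgD; first exact: cvg_cst.
  by apply: cvg_edot; apply: cvgB => //; exact: cvg_cst.
have hc : {within `[0, last 0 s], continuous h}.
  rewrite s1 => t; apply: cvgM; first exact: cvg_cst.
  by apply: cvgV; [rewrite gt_eqF|apply: cvgQ; [exact: nbhs_subspace_filter|exact: gc]].
have hd i : (i < size s)%N -> forall x, nth 0 (0 :: s) i < x < nth 0 s i ->
    is_derive x 1 h (f x) /\ {for x, continuous f}.
  move=> /sP[gd dgc _ _] x xi; have gx := gd x xi.
  have gcx : {for x, continuous g}.
    by apply: differentiable_continuous; apply/derivable1_diffP.
  have dgcx : {for x, continuous (derive1 g)}.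
    have := dgc; rewrite continuous_open_subspace; last exact: interval_open.
    by apply; rewrite inE /= in_itv.
  split.
    have dQ : is_derive x 1 (fun t => e ^+ 2 + Q t) (2 * edot (g x - p) (derive1 g x)).
      rewrite -[X in is_derive _ _ _ X]add0r.
      apply: (@is_deriveD _ _ _ (cst (e ^+ 2)) Q).
      exact: is_derive_edot_sqr.
    have dV := @is_deriveV _ _ x _ 1 (lt0r_neq0 (Q0 x)) dQ.
    have -> : f x = (- (K * e ^+ 3)) *:
        (- (e ^+ 2 + Q x) ^- 2 *: (2 * edot (g x - p) (derive1 g x))).
      by rewrite /f /GRing.scale /=; field; rewrite gt_eqF.
    exact: is_deriveZ.
  apply: cvgM.
    apply: cvgM; first exact: cvg_cst.
    apply: cvgM; first exact: cvg_cst.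
    by apply: cvg_edot => //; apply: cvgB => //; exact: cvg_cst.
  apply: cvgV; first by rewrite expf_neq0 // gt_eqF.
  by apply: cvgM; exact: cvgQ.
have [_] := increment_le_integral_path s01 hc hd; rewrite s1 => hI.
apply: (@le_trans _ _ (h 1 - h 0)%:E).
  have Q00 : Q 0 = 0 by rewrite /Q g0 subrr -sqr_enorm enorm0 expr0n.
  have Q1 : e ^+ 2 <= Q 1.
    by rewrite /Q g1 -sqr_enorm enorm_distC lerXn2r // nnegrE ?enorm_ge0 // ltW.
  have -> : h 1 - h 0 = K * e * (Q 1 / (e ^+ 2 + Q 1)).
    rewrite /h Q00; field; rewrite !gt_eqF //=.
  have half : 2^-1 <= Q 1 / (e ^+ 2 + Q 1).
    by rewrite ler_pdivlMr //; lra.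
  rewrite lee_fin; have -> : C / delta Om p `^ beta / 4 * e = K * e * 2^-1.
    by rewrite /K; field; rewrite gt_eqF.
  by rewrite ler_pM2l // mulr_gt0.
apply: le_trans hI _; apply: ge0_le_integral_nonmeasurable => t; rewrite /= in_itv //=.
move=> t01; rewrite lee_fin; have ot := gOm _ t01.
apply: le_trans (F_lower_ball (derive1 g t) op ot (e := e) _); last by rewrite e0.
have -> : `|f t| =
    K * e ^+ 3 * (2 * `|edot (g t - p) (derive1 g t)|) / (e ^+ 2 + Q t) ^+ 2.
  have Ke : 0 <= K * e ^+ 3 by rewrite mulr_ge0 ?exprn_ge0 ?(ltW K0) ?(ltW e0).
  have q2 : 0 <= (e ^+ 2 + Q t) ^+ 2 by rewrite sqr_ge0.
  by rewrite /f normrM normfV (ger0_norm q2) normrM (ger0_norm Ke) normrM (ger0_norm (ler0n R 2)).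
rewrite ler_pdivrMr ?exprn_gt0 //.
set X := derive1 g t; set rho := enorm (g t - p).
have rho0 : 0 <= rho := enorm_ge0 _.
have er0 : 0 < e + rho by rewrite ltr_pwDl.
have QE : Q t = rho ^+ 2 by rewrite /rho sqr_enorm.
rewrite QE.
apply: (@le_trans _ _ (K * e ^+ 3 * (2 * (rho * enorm X)))).
  apply: ler_wpM2l; first by rewrite mulr_ge0 ?exprn_ge0 ?(ltW K0) ?(ltW e0).
  by apply: ler_wpM2l => //; exact: edot_norm_le.
have -> : K * e ^+ 3 * (2 * (rho * enorm X)) =
    C * enorm X / (delta Om p `^ beta) * (e ^+ 3 * rho).
  by rewrite /K; field; rewrite gt_eqF.
have -> : C * enorm X * e / (delta Om p `^ beta * (e + rho)) * (e ^+ 2 + rho ^+ 2) ^+ 2 =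
    C * enorm X / (delta Om p `^ beta) * (e * (e ^+ 2 + rho ^+ 2) ^+ 2 / (e + rho)).
  by field; rewrite !gt_eqF.
apply: ler_wpM2l; first by rewrite divr_ge0 ?mulr_ge0 ?enorm_ge0 ?(ltW C0) ?(ltW rb).
by rewrite ler_pdivlMr // rational_weight_le.
Qed.

Lemma F_length_ge0 x y g : admissible Om x y g -> (0 <= F_length F g)%E.
Proof.
move=> [_ gOm _ _]; apply: integral_ge0 => t; rewrite /= in_itv /= => t01.
by rewrite lee_fin; apply: F0; exact: gOm.
Qed.

Lemma dF_ge0 x y : 0 <= dF Om F x y.
Proof. by apply: fine_ge0; apply: le_ereal_inf_tmp => _ [g /F_length_ge0 ? <-]. Qed.

(** [F_length_lower] with the minimum as [e]. Once the right side is below [delta Om p], this bounds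
    the Euclidean distance. *)
Lemma min_dist_delta_le (p q : Cn R n) : dF_separates Om F -> Om p -> Om q ->
  Num.min (enorm (p - q)) (delta Om p) <= 4 * delta Om p `^ beta / C * dF Om F p q.
Proof.
move=> sep op oq; have r0 := delta0 op.
have rb : 0 < delta Om p `^ beta by rewrite powR_gt0.
have [->|pq] := eqVneq p q.
  rewrite subrr enorm0 min_l; last exact: ltW (delta0 oq).
  by rewrite mulr_ge0 ?dF_ge0 // divr_ge0 ?(ltW C0) // mulr_ge0 ?powR_ge0.
set e := Num.min _ _.
have e0 : 0 < e.
  rewrite lt_min r0 andbT lt_def enorm_ge0 andbT.
  by apply/eqP => /enorm_eq0 /eqP; rewrite subr_eq0 (negPf pq).
have dlow : ((C / (delta Om p `^ beta) / 4 * e)%:E <=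
    ereal_inf [set F_length F g | g in admissible Om p q])%E.
  apply: le_ereal_inf_tmp => _ [g ag <-].
  by apply: F_length_lower ag _ _ _ => //; rewrite ge_min lexx ?orbT.
(* [dF] is [0] when the infimum is [+oo]; separation rules this out since [p != q]. *)
have : dF Om F p q <> 0 by move=> /(sep _ _ op oq) /eqP; rewrite (negPf pq).
rewrite /dF; case: (ereal_inf _) dlow => [d||] //= dlow _.
rewrite lee_fin in dlow.
have k0 : 0 <= 4 * delta Om p `^ beta / C by rewrite divr_ge0 ?mulr_ge0 ?(ltW rb) ?(ltW C0).
apply: le_trans (ler_wpM2l k0 dlow).
have -> : 4 * delta Om p `^ beta / C * (C / delta Om p `^ beta / 4 * e) = e => //.
by field; rewrite !gt_eqF.
Qed.

End LocalEstimate.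

(** * Euclidean length under exponentially decaying speed bounds *)

(** Chain steps of length [eta / 2]; the increments of [W] telescope. *)
Lemma increment_of_local (R : realType) (m : R -> R -> R) (W : R -> R) (a b eta : R) :
  0 < eta -> (forall r s t, m s t <= m s r + m r t) ->
  (forall s t, a <= s -> s <= t -> t <= b -> t - s < eta -> m s t <= W t - W s) ->
  forall s t, a <= s -> s <= t -> t <= b -> m s t <= W t - W s.
Proof.
move=> eta0 mtri loc.
have steps N s t : a <= s -> s <= t -> t <= b -> t - s <= N%:R * (eta / 2) ->
    m s t <= W t - W s.
  elim: N s => [|N IH] s as_ st tb; first by rewrite mul0r => h; apply: loc => //; lra.
  rewrite -natr1 => h; have [h1|h1] := ltP (t - s) eta; first exact: loc.
  have := mtri (s + eta / 2) s t.
  have := loc s (s + eta / 2) as_ ltac:(lra) ltac:(lra) ltac:(lra).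
  have := IH (s + eta / 2) ltac:(lra) ltac:(lra) tb ltac:(lra); lra.
move=> s t as_ st tb; apply: (steps (Num.truncn ((t - s) / (eta / 2))).+1) => //.
by rewrite -ler_pdivrMr ?divr_gt0 // ltW // truncnS_gt.
Qed.

(** [W] is a primitive of the exponential bound. As the weight is taken at the left end of each
    step, [1 + x <= expR x] replaces integration. *)
Lemma increment_le_of_exp_growth (R : realType) (m : R -> R -> R) (w : R -> R)
    (a b eta kappa B : R) :
  a <= b -> 0 < eta -> 0 < kappa -> 0 <= B -> (forall r s t, m s t <= m s r + m r t) ->
  (forall s t, a <= s -> s <= t -> t <= b -> t - s < eta -> m s t <= w s * (t - s)) ->
  (forall s, a <= s <= b -> w s <= B * expR (kappa * (s - b))) ->
  exists2 W : R -> R, W b - W a <= B / kappa &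
    forall s t, a <= s -> s <= t -> t <= b -> m s t <= W t - W s.
Proof.
move=> ab eta0 k0 B0 mtri loc wB.
exists (fun s => B / kappa * expR (kappa * (s - b))).
  rewrite subrr mulr0 expR0 mulr1 gerBl mulr_ge0 ?expR_ge0 //.
  by rewrite divr_ge0 // ltW.
apply: (increment_of_local eta0 mtri) => s t as_ st tb tse.
apply: le_trans (loc _ _ as_ st tb tse) _.
apply: (@le_trans _ _ (B * expR (kappa * (s - b)) * (t - s))).
  by apply: ler_wpM2r; [lra|apply: wB; lra].
have -> : kappa * (t - b) = kappa * (s - b) + kappa * (t - s) by ring.
rewrite expRD; set E := expR (kappa * (s - b)).
have E0 : 0 <= B / kappa * E by rewrite mulr_ge0 ?divr_ge0 ?expR_ge0 // ltW.
have -> : B * E * (t - s) = B / kappa * E * (kappa * (t - s)).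
  by field; rewrite gt_eqF.
have := ler_wpM2l E0 (expR_ge1Dx (kappa * (t - s))); lra.
Qed.

Section EuclideanLength.
Variables (R : realType) (n : nat) (g : R -> Cn R n).

Lemma poly_len_cons2 a u (s : seq R) :
  poly_len g [:: a, u & s] = enorm (g u - g a) + poly_len g (u :: s).
Proof. by rewrite /poly_len /= big_ord_recl. Qed.

Lemma poly_len_le (W : R -> R) (b : R) (s : seq R) (a : R) :
  (forall s t, a <= s -> s <= t -> t <= b -> enorm (g t - g s) <= W t - W s) ->
  path <%R a s -> last a s = b -> poly_len g (a :: s) <= W b - W a.
Proof.
elim: s a => [|u s IH] a gW /=.
  by move=> _ ->; rewrite /poly_len /= big_ord0 subrr.
move=> /andP[au us] lb; have ub : u <= b by rewrite -lb le_last_path.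
rewrite poly_len_cons2.
have := gW a u (lexx a) (ltW au) ub.
have := IH u (fun s t us => gW s t (le_trans (ltW au) us)) us lb; lra.
Qed.

(** The bound makes the polygonal lengths bounded above, so that [sup] is a true supremum. *)
Lemma euclid_length_le (W : R -> R) (a b : R) : a < b ->
  (forall s t, a <= s -> s <= t -> t <= b -> enorm (g t - g s) <= W t - W s) ->
  0 <= euclid_length g a b <= W b - W a.
Proof.
move=> ab gW; rewrite /euclid_length; set S := (X in sup X).
have ubS : ubound S (W b - W a).
  by move=> _ [s /= [ps ls] <-]; apply: poly_len_le.
have Sab : S (enorm (g b - g a)).
  exists [:: b]; first by rewrite /= ab.
  by rewrite poly_len_cons2 /poly_len /= big_ord0 addr0.
apply/andP; split; last by apply: ge_sup => //; exists (enorm (g b - g a)).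
apply: le_trans (enorm_ge0 (g b - g a)) _.
by apply: ub_le_sup => //; exists (W b - W a).
Qed.

(** The local bound is required at both ends of a short step so that each half can use the end
    farther from [c], where the exponential bound is smaller. *)
Lemma euclid_length_split_le (w : R -> R) (a c b eta kappa B1 B2 : R) :
  a < b -> a <= c <= b -> 0 < eta -> 0 < kappa -> 0 <= B1 -> 0 <= B2 ->
  (forall s t, a <= s -> s <= t -> t <= b -> t - s < eta ->
     enorm (g t - g s) <= w s * (t - s) /\ enorm (g t - g s) <= w t * (t - s)) ->
  (forall s, a <= s <= c -> w s <= B1 * expR (kappa * (s - c))) ->
  (forall s, c <= s <= b -> w s <= B2 * expR (kappa * (c - s))) ->
  0 <= euclid_length g a b <= (B1 + B2) / kappa.
Proof.
move=> ab /andP[ac cb] eta0 k0 B10 B20 loc w1 w2.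
have gtri r s t : enorm (g t - g s) <= enorm (g r - g s) + enorm (g t - g r).
  by rewrite [leRHS]addrC enorm_dist_triangle.
have [|W1 W1c gW1] := increment_le_of_exp_growth ac eta0 k0 B10 gtri (w := w) _ w1.
  by move=> s t as_ st tc tse; apply: (loc s t as_ st _ tse).1; lra.
(* The right half is the left half read backwards in time. *)
have gtri' r s t : enorm (g (- s) - g (- t)) <= enorm (g (- s) - g (- r)) + enorm (g (- r) - g (- t)).
  exact: enorm_dist_triangle.
have bc : - b <= - c by lra.
have [|s|W2 W2c gW2] :=
    increment_le_of_exp_growth bc eta0 k0 B20 gtri' (w := fun s => w (- s)) _ _.
- move=> s t bs st tc tse.
  have := (loc (- t) (- s) ltac:(lra) ltac:(lra) ltac:(lra) ltac:(lra)).2.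
  by rewrite opprK [- s + t]addrC.
- move=> sbc; have -> : s - - c = c - - s by ring.
  by apply: w2; lra.
(* Glues both primitives at [c]: on either side one term is constant. *)
pose W t := W1 (Num.min t c) - W2 (- Num.max t c).
have gW s t : a <= s -> s <= t -> t <= b -> enorm (g t - g s) <= W t - W s.
  move=> as_ st tb; rewrite /W.
  have [tc|ct] := leP t c; have [sc|cs] := leP s c.
  - by have := gW1 s t as_ st tc; lra.
  - by exfalso; lra.
  - have := gtri c s t; have := gW1 s c as_ sc (lexx c).
    by have := gW2 (- t) (- c) ltac:(lra) ltac:(lra) (lexx _); rewrite !opprK; lra.
  - by have := gW2 (- t) (- s) ltac:(lra) ltac:(lra) ltac:(lra); rewrite !opprK; lra.
have /andP[-> h] := euclid_length_le ab gW.
apply: le_trans h _; rewrite /W (min_r cb) (max_l cb) (min_l ac) (max_r ac).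
rewrite mulrDl; lra.
Qed.
End EuclideanLength.

Lemma quasi_geodesic_restrict (R : realType) (n : nat) (Om : set (Cn R n))
    (F : Cn R n -> Cn R n -> R) (lam : R) (g : R -> Cn R n) (a b c e : R) :
  a <= c -> e <= b -> quasi_geodesic Om F lam g a b -> quasi_geodesic Om F lam g c e.
Proof.
move=> ac eb [og qg]; have ce t : c <= t <= e -> a <= t <= b by lra.
by split=> [t /ce /og //|s t /ce sab /ce tab]; exact: qg.
Qed.

(** * Boundary distance and speed along a quasi-geodesic *)

Section DeltaAlongCurve.
Variables (R : realType) (n : nat) (Om : set (Cn R n)) (F : Cn R n -> Cn R n -> R).
Variables (C1 C2 alpha beta lam : R).
Hypotheses (C20 : 0 < C2) (beta01 : 0 < beta < 1) (alpha0 : 0 < alpha) (lam1 : 1 <= lam)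
  (F0 : forall z X, Om z -> 0 <= F z X) (delta0 : forall z, Om z -> 0 < delta Om z)
  (sep : dF_separates Om F)
  (FC : forall z X, Om z -> X != 0 -> C2 * enorm X / (delta Om z) `^ beta <= F z X)
  (dlog : forall x y, Om x -> Om y ->
     alpha * `|ln (delta Om x / delta Om y)| - C1 <= dF Om F x y).

Lemma delta_le_expR x y : Om x -> Om y ->
  delta Om y <= expR (ln (delta Om x) + (C1 + dF Om F x y) / alpha).
Proof.
move=> ox oy; have x0 := delta0 ox; have y0 := delta0 oy.
rewrite -[leLHS](lnK y0) ler_expR.
have := dlog ox oy; rewrite ln_div ?posrE // distrC.
have := ler_norm (ln (delta Om y) - ln (delta Om x)).
rewrite -(ler_pM2l alpha0) => h1 h2.
by rewrite -lerBlDl ler_pdivlMr // mulrC; lra.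
Qed.

(** [eta] may depend on the curve, because it disappears from the bound in [euclid_length_split_le];
    the weight [w] has uniform constants. *)
Lemma quasi_geodesic_local_length g a b : a <= b -> quasi_geodesic Om F lam g a b ->
  exists2 eta, 0 < eta & forall s t, a <= s -> s <= t -> t <= b -> t - s < eta ->
    let w u := 4 * lam / C2 * delta Om (g u) `^ beta in
    enorm (g t - g s) <= w s * (t - s) /\ enorm (g t - g s) <= w t * (t - s).
Proof.
move=> ab [og qg]; have /andP[b0 b1] := beta01.
have lam0 : 0 < lam by rewrite (lt_le_trans ltr01).
have oa : Om (g a) by apply: og; rewrite lexx.
pose L := 4 * lam / C2; have L0 : 0 < L by rewrite divr_gt0 ?mulr_gt0.
(* A positive lower bound for [delta] on the curve, as [dF] from [g a] is at most
   [lam * (b - a)]. *)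
pose m := expR (ln (delta Om (g a)) - (C1 + lam * (b - a)) / alpha).
have m0 : 0 < m by rewrite expR_gt0.
have mle u : a <= u <= b -> m <= delta Om (g u).
  move=> uab; have ou := og _ uab.
  have := delta_le_expR ou oa; rewrite -[leLHS](lnK (delta0 oa)) ler_expR => h.
  rewrite -(lnK (delta0 ou)) ler_expR lerBlDr; apply: le_trans h _.
  rewrite lerD2l ler_pM2r ?invr_gt0 // lerD2l.
  have aab : a <= a <= b by rewrite lexx.
  have /andP[_ /le_trans] := qg _ _ aab uab; apply.
  by rewrite ler_pM2l // ger0_norm; lra.
(* For such [r] the right side of [min_dist_delta_le] is below [delta Om p], so the minimum is the
   Euclidean distance. *)
have step p q r : Om p -> Om q -> m <= delta Om p -> 0 <= r ->
    dF Om F p q <= lam * r -> r < m `^ (1 - beta) / L ->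
    enorm (p - q) <= L * delta Om p `^ beta * r.
  move=> op oq mp r0 dr rm; have p0 := delta0 op.
  have pb : 0 < delta Om p `^ beta by rewrite powR_gt0.
  have := min_dist_delta_le C20 beta01 F0 delta0 FC sep op oq.
  have k0 : 0 <= 4 * delta Om p `^ beta / C2 by rewrite divr_ge0 ?mulr_ge0 ?(ltW pb) ?(ltW C20).
  move=> /le_trans/(_ (ler_wpM2l k0 dr)).
  have -> : 4 * delta Om p `^ beta / C2 * (lam * r) = L * delta Om p `^ beta * r.
    by rewrite /L; field; rewrite gt_eqF.
  rewrite ge_min => /orP[//|h]; exfalso.
  have : L * delta Om p `^ beta * r < delta Om p.
    rewrite ltr_pdivlMr // in rm.
    have mb : m `^ (1 - beta) <= delta Om p `^ (1 - beta).
      by apply: ge0_ler_powR; rewrite ?nnegrE ?(ltW m0) ?(ltW p0) //; lra.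
    have E : delta Om p `^ beta * delta Om p `^ (1 - beta) = delta Om p.
      by rewrite -powRD ?(gt_eqF p0) ?implybT // addrC subrK powRr1 // ltW.
    rewrite -[ltRHS]E mulrAC mulrC ltr_pM2l // mulrC.
    exact: lt_le_trans rm mb.
  by rewrite ltNge h.
exists (m `^ (1 - beta) / L) => [|s t as_ st tb ts w]; first by rewrite divr_gt0 ?powR_gt0.
have sab : a <= s <= b by lra.
have tab : a <= t <= b by lra.
have ts0 : 0 <= t - s by lra.
have /andP[_ d1] := qg _ _ sab tab; have /andP[_ d2] := qg _ _ tab sab.
rewrite ger0_norm // in d1; rewrite distrC ger0_norm // in d2.
split; last exact: (step _ _ _ (og _ tab) (og _ sab) (mle _ tab) ts0 d1 ts).
rewrite enorm_distC.
exact: (step _ _ _ (og _ sab) (og _ tab) (mle _ sab) ts0 d2 ts).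
Qed.

Lemma weight_le_expR x y (A : R) : Om x -> Om y ->
  ln (delta Om x) + (C1 + dF Om F x y) / alpha <= A ->
  4 * lam / C2 * delta Om y `^ beta <= 4 * lam / C2 * expR (beta * A).
Proof.
move=> ox oy hA; have /andP[b0 _] := beta01; have y0 := delta0 oy.
have lam0 : 0 < lam by rewrite (lt_le_trans ltr01).
apply: ler_wpM2l; first by rewrite divr_ge0 ?mulr_ge0 ?(ltW C20) ?(ltW lam0).
have h : delta Om y <= expR A by apply: le_trans (delta_le_expR ox oy) _; rewrite ler_expR.
rewrite [beta * A]mulrC expRM.
by apply: ge0_ler_powR; rewrite ?nnegrE ?(ltW b0) ?(ltW y0) // expR_ge0.
Qed.

End DeltaAlongCurve.

(** * The cut point and the final constant *)

Theorem theorem1p2 (R : realType) (n : nat) (Om : set (Cn R n))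
    (F : Cn R n -> Cn R n -> R) (C1 C2 alpha beta : R) :
  (2 <= n)%N -> bounded_domain Om -> is_finsler Om F ->
  dF_complete Om F -> gromov_hyperbolic Om F ->
  0 < C1 -> 0 < C2 -> 0 < alpha -> 0 < beta < 1 ->
  (forall x y, Om x -> Om y ->
     alpha * `|ln (delta Om x / delta Om y)| - C1 <= dF Om F x y) ->
  (forall z X, Om z -> X != 0 ->
     C2 * enorm X / (delta Om z) `^ beta <= F z X) ->
  forall lam : R, 1 <= lam -> exists C : R, 0 < C /\
    forall (x y : Cn R n) (g : R -> Cn R n) (a b : R),
      Om x -> Om y -> a < b -> g a = x -> g b = y ->
      quasi_geodesic Om F lam g a b ->
      2 * alpha * ln ((euclid_length g a b) `^ beta^-1
                      / Num.sqrt (delta Om x * delta Om y)) - C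
        <= dF Om F x y.
Proof.
move=> _ [_ oOm _ _] [F0 _ _] _ [sep _ geo [del [del0 hyp]]].
move=> C10 C20 alpha0 beta01 dlog FC lam lam1.
have /andP[beta0 beta1] := beta01.
have d0 x y : 0 <= dF Om F x y by exact: dF_ge0.
(* Vanishing on the diagonal and symmetry are read off from geodesics. *)
have dxx x : Om x -> dF Om F x x = 0.
  move=> ox; have [sigma [s0 _ sP]] := geo x x ox ox.
  have z : 0 <= (0 : R) <= dF Om F x x by rewrite lexx d0.
  by have [_] := sP 0 0 z z; rewrite s0 subrr normr0.
have dC x y : Om x -> Om y -> dF Om F x y = dF Om F y x.
  move=> ox oy; have [sigma [s0 sD sP]] := geo x y ox oy.
  have z : 0 <= (0 : R) <= dF Om F x y by rewrite lexx d0.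
  have D : 0 <= dF Om F x y <= dF Om F x y by rewrite lexx d0.
  by have [_] := sP _ _ D z; rewrite s0 sD subr0 ger0_norm ?d0.
have [M M0 stab] := quasi_geodesic_stability del0 d0 dxx dC hyp geo lam1.
pose Lam := 4 * lam / C2; pose kappa := beta / (alpha * lam).
have lam0 : 0 < lam by rewrite (lt_le_trans ltr01).
have Lam0 : 0 < Lam by rewrite divr_gt0 ?mulr_gt0.
have kappa0 : 0 < kappa by rewrite divr_gt0 ?mulr_gt0.
(* [c0] collects the additive errors of [wy], the larger ones; [K] below absorbs the factor
   [2 * Lam / kappa] of the length bound. *)
pose c0 := 3 / 2 * C1 + 2 * M + lam + 2 * del.
have c00 : 0 <= c0 by rewrite /c0; lra.
pose K := 2 * alpha / beta * `|ln (2 * Lam / kappa)|.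
have K0 : 0 <= K by rewrite mulr_ge0 ?divr_ge0 ?mulr_ge0 ?(ltW alpha0) ?(ltW beta0).
exists (2 * c0 + K + 1); split; first lra.
move=> x y g a b ox oy ab ga gb qg.
(* By the conventions [ln 0 = 0] and [0^-1 = 0], an empty boundary or zero length leaves only
   nonnegativity of [dF] to use. *)
have trivial_case r : r = 0 -> 2 * alpha * ln r - (2 * c0 + K + 1) <= dF Om F x y.
  by move=> ->; have := d0 x y; rewrite ln0 // mulr0; lra.
have [bne|/delta_eq0 dz] := pselect (closure Om `\` Om !=set0); last first.
  by apply: trivial_case; rewrite dz mul0r sqrtr0 invr0 mulr0.
have delta_pos z : Om z -> 0 < delta Om z by move=> oz; exact: delta_gt0.
have x0 := delta_pos _ ox; have y0 := delta_pos _ oy.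
have [eta eta0 loc] :=
  quasi_geodesic_local_length C20 beta01 alpha0 lam1 F0 delta_pos sep FC dlog (ltW ab) qg.
have [og qgd] := qg.
set D := dF Om F x y; set lx := ln (delta Om x); set ly := ln (delta Om y).
(* The value of the distance from [x] at which [lx + S / alpha] and [ly + (D - S) / alpha] agree. *)
pose S := (D + alpha * (ly - lx)) / 2.
have D0 : 0 <= D by exact: d0.
have SD : - (C1 / 2) <= S /\ S <= D + C1 / 2.
  have := dlog _ _ ox oy; rewrite ln_div ?posrE // -/lx -/ly -/D.
  rewrite -{1}(gtr0_norm alpha0) -normrM lerBlDr ler_norml => /andP[h1 h2].
  by rewrite /S; split; lra.
have [s [t [sab tab st fs ft]]] : exists s t, [/\ a <= s <= b, a <= t <= b, `|s - t| <= 1,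
    dF Om F x (g s) <= S + C1 / 2 & S - C1 / 2 <= dF Om F x (g t)].
  apply: (@unit_step_crossing _ (fun u => dF Om F x (g u) <= S + C1 / 2)
    (fun u => S - C1 / 2 <= dF Om F x (g u)) a b (ltW ab)).
  - move=> u _; have [h|h] := leP (dF Om F x (g u)) (S + C1 / 2); [by left|right]; lra.
  - by rewrite ga dxx //; have := SD.1; lra.
  - by rewrite gb -/D; have := SD.2; lra.
have os := og _ sab; have ot := og _ tab.
(* The lower bound at [t] passes to [s] at the cost of [lam + 2 * del], so [s] can be the cut
   point. *)
have fst_ : S - C1 / 2 - lam - 2 * del <= dF Om F x (g s).
  have := coarse_triangle dxx dC hyp ox ot os.
  have /andP[_ h] := qgd _ _ tab sab.
  have : lam * `|s - t| <= lam by rewrite ler_piMr // ltW.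
  lra.
have := stab g a b s qg sab; rewrite ga gb -/D => es.
have aab : a <= a <= b by rewrite lexx ltW.
have bab : a <= b <= b by rewrite lexx ltW.
pose A := (lx + ly) / 2 + D / (2 * alpha) + c0 / alpha.
pose w u := Lam * delta Om (g u) `^ beta.
(* Stability on the part from [a] to [s] gives [dF Om F x (g u) <= dF Om F x (g s) + M - (s - u) /
   lam], the source of the decay. *)
have wx u : a <= u <= s -> w u <= Lam * expR (beta * A) * expR (kappa * (u - s)).
  move=> /andP[au us]; have uab : a <= u <= b by lra.
  have ou := og _ uab.
  rewrite /w -mulrA -expRD.
  have -> : beta * A + kappa * (u - s) = beta * (A + (u - s) / (alpha * lam)).
    by rewrite /kappa; field; rewrite !gt_eqF.
  apply: (weight_le_expR C20 beta01 alpha0 lam1 delta_pos dlog ox ou).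
  have qs := quasi_geodesic_restrict (lexx a) (andP sab).2 qg.
  have := stab g a s u qs ltac:(lra); rewrite ga => h.
  have /andP[h1 _] := qgd _ _ uab sab; rewrite (dC _ _ os ou) ger0_norm in h1; last lra.
  rewrite -(ler_pM2l alpha0) /A -/lx.
  have -> : alpha * (lx + (C1 + dF Om F x (g u)) / alpha) =
    alpha * lx + C1 + dF Om F x (g u) by field; rewrite gt_eqF.
  have -> : alpha * ((lx + ly) / 2 + D / (2 * alpha) + c0 / alpha + (u - s) / (alpha * lam)) =
    alpha * (lx + ly) / 2 + D / 2 + c0 - lam^-1 * (s - u) by field; rewrite !gt_eqF.
  rewrite /S in fs; rewrite /c0; lra.
have wy u : s <= u <= b -> w u <= Lam * expR (beta * A) * expR (kappa * (s - u)).
  move=> /andP[su ub]; have uab : a <= u <= b by lra.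
  have ou := og _ uab.
  rewrite /w -mulrA -expRD.
  have -> : beta * A + kappa * (s - u) = beta * (A + (s - u) / (alpha * lam)).
    by rewrite /kappa; field; rewrite !gt_eqF.
  apply: (weight_le_expR C20 beta01 alpha0 lam1 delta_pos dlog oy ou).
  have qs := quasi_geodesic_restrict (andP sab).1 (lexx b) qg.
  have := stab g s b u qs ltac:(lra); rewrite gb => h.
  have /andP[h1 _] := qgd _ _ uab sab; rewrite distrC ger0_norm in h1; last lra.
  rewrite -(ler_pM2l alpha0) /A -/ly (dC _ _ oy ou).
  have -> : alpha * (ly + (C1 + dF Om F (g u) y) / alpha) =
    alpha * ly + C1 + dF Om F (g u) y by field; rewrite gt_eqF.
  have -> : alpha * ((lx + ly) / 2 + D / (2 * alpha) + c0 / alpha + (s - u) / (alpha * lam)) =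
    alpha * (lx + ly) / 2 + D / 2 + c0 - lam^-1 * (u - s) by field; rewrite !gt_eqF.
  rewrite /S in fst_; rewrite /c0; lra.
have B0 : 0 <= Lam * expR (beta * A) by rewrite mulr_ge0 ?expR_ge0 ?(ltW Lam0).
have /andP[L0 LB] := euclid_length_split_le ab sab eta0 kappa0 B0 B0 loc wx wy.
set L := euclid_length g a b in L0 LB *.
have [Lz|Lnz] := eqVneq L 0.
  by apply: trivial_case; rewrite Lz powR0 ?mul0r // invr_eq0 gt_eqF.
have Lp : 0 < L by rewrite lt_def Lnz.
have lnL : ln L <= ln (2 * Lam / kappa) + beta * A.
  have q0 : 0 < 2 * Lam / kappa := divr_gt0 (mulr_gt0 (ltr0Sn R 1) Lam0) kappa0.
  have qe0 : 0 < 2 * Lam / kappa * expR (beta * A) := mulr_gt0 q0 (expR_gt0 _).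
  rewrite -[X in _ + X]expRK -lnM ?posrE ?expR_gt0 // ler_ln ?posrE //.
  by apply: le_trans LB _; rewrite le_eqVlt; apply/orP; left; apply/eqP; field; rewrite gt_eqF.
have xy0 : 0 < delta Om x * delta Om y by rewrite mulr_gt0.
rewrite ln_div ?posrE ?powR_gt0 ?sqrtr_gt0 // ln_powR.
have -> : ln (Num.sqrt (delta Om x * delta Om y)) = (lx + ly) / 2.
  have : ln (Num.sqrt (delta Om x * delta Om y) ^+ 2) = lx + ly.
    by rewrite sqr_sqrtr ?(ltW xy0) // lnM ?posrE.
  by rewrite lnXn ?sqrtr_gt0 // => <-; rewrite -mulr_natr; field.
have lnK' : ln (2 * Lam / kappa) <= `|ln (2 * Lam / kappa)| by exact: ler_norm.
have k0 : 0 <= 2 * alpha / beta by rewrite divr_ge0 ?mulr_ge0 ?(ltW alpha0) ?(ltW beta0).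
have := ler_wpM2l k0 lnL; have := ler_wpM2l k0 lnK'; rewrite -/K => h1 h2.
(* The factor [2 * alpha / beta] gives [D] coefficient 1 and makes the terms [alpha * (lx + ly)]
   cancel. *)
have h3 : 2 * alpha / beta * (ln (2 * Lam / kappa) + beta * A) =
  2 * alpha / beta * ln (2 * Lam / kappa) + alpha * (lx + ly) + D + 2 * c0.
  by rewrite /A; field; rewrite !gt_eqF.
have -> : 2 * alpha * (beta^-1 * ln L - (lx + ly) / 2) =
  2 * alpha / beta * ln L - alpha * (lx + ly) by field; rewrite gt_eqF.
lra.
Qed.
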